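(* There is a polynomial-time algorithm that, given a graph $G\in\mathrm{BP2}\setminus\mathrm{BP1}$, decides whether $G$ admits a star-biclique partition, i.e. whether $V(G)$ can be partitioned into two sets $S,T$ such that $G[S]$ contains a spanning subgraph that is a star and $G[T]$ contains a spanning subgraph that is a biclique.
   Context: All graphs are finite, simple and undirected. A biclique of a graph $G$ is a subgraph of $G$ isomorphic to $K_1$ or to $K_{m,n}$ for some $m,n\ge1$; a star is a biclique isomorphic to $K_1$ or to $K_{1,n}$ for some $n\ge1$. BP$k$ is the set of graphs whose vertex set can be covered by at most $k$ bicliques (equivalently partitioned into at most $k$ parts, each the vertex set of a biclique). *)

(* Defs.v *)
From HB Require Import structures.
From mathcomp Require Import all_boot all_order all_algebra.

Set Implicit Arguments.
Unset Strict Implicit.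
Unset Printing Implicit Defensive.

Record sgraph := SGraph {
  vertex :> finType;
  adj : rel vertex;
  adj_sym : symmetric adj;
  adj_irr : irreflexive adj
}.

Definition isomorphic (G H : sgraph) : Prop :=
  exists2 f : G -> H, bijective f & forall x y, adj (f x) (f y) = adj x y.

Definition K1_adj : rel unit := fun _ _ => false.
Lemma K1_sym : symmetric K1_adj. Proof. by []. Qed.
Lemma K1_irr : irreflexive K1_adj. Proof. by []. Qed.
Definition K1 : sgraph := SGraph K1_sym K1_irr.

Definition Kbip_adj (m n : nat) : rel ('I_m + 'I_n)%type := fun u v =>
  match u, v with
  | inl _, inr _ | inr _, inl _ => true
  | _, _ => false
  end.
Lemma Kbip_sym m n : symmetric (@Kbip_adj m n).
Proof. by move=> [?|?] [?|?]. Qed.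
Lemma Kbip_irr m n : irreflexive (@Kbip_adj m n).
Proof. by move=> [?|?]. Qed.
Definition Kbip (m n : nat) : sgraph := SGraph (@Kbip_sym m n) (@Kbip_irr m n).

Record subgraph (G : sgraph) := Subgraph {
  sub_verts : {set G};
  sub_edge : rel G;
  sub_edge_sym : symmetric sub_edge;
  sub_edgeP : forall x y, sub_edge x y ->
    [&& x \in sub_verts, y \in sub_verts & adj x y]
}.

Section SubgraphGraph.
Variables (G : sgraph) (H : subgraph G).
Definition subgraph_adj : rel {x : G | x \in sub_verts H} :=
  fun x y => sub_edge H (val x) (val y).
Lemma subgraph_sym : symmetric subgraph_adj.
Proof. by move=> x y; apply: sub_edge_sym. Qed.
Lemma subgraph_irr : irreflexive subgraph_adj.
Proof.
move=> x; apply/negP => /sub_edgeP /and3P[_ _].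
by rewrite adj_irr.
Qed.
Definition graph_of_subgraph : sgraph := SGraph subgraph_sym subgraph_irr.
End SubgraphGraph.
Coercion graph_of_subgraph : subgraph >-> sgraph.

Section Induced.
Variables (G : sgraph) (S : {set G}).
Definition induced_adj : rel {x : G | x \in S} := fun x y => adj (val x) (val y).
Lemma induced_sym : symmetric induced_adj.
Proof. by move=> x y; apply: adj_sym. Qed.
Lemma induced_irr : irreflexive induced_adj.
Proof. by move=> x; apply: adj_irr. Qed.
Definition induced : sgraph := SGraph induced_sym induced_irr.
End Induced.

Definition is_biclique (H : sgraph) : Prop :=
  isomorphic H K1 \/
  exists m n : nat, [/\ 1 <= m, 1 <= n & isomorphic H (Kbip m n)].

Definition is_star (H : sgraph) : Prop :=
  isomorphic H K1 \/
  exists n : nat, 1 <= n /\ isomorphic H (Kbip 1 n).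

Definition BP (k : nat) (G : sgraph) : Prop :=
  exists (l : nat) (B : 'I_l -> subgraph G),
    [/\ l <= k,
        forall i, is_biclique (B i)
      & forall x : G, exists i, x \in sub_verts (B i)].

Definition has_spanning (P : sgraph -> Prop) (G : sgraph) : Prop :=
  exists H : subgraph G, sub_verts H = [set: G] /\ P H.

Definition star_biclique_partition (G : sgraph) : Prop :=
  exists S T : {set G},
    [/\ S :|: T = [set: G],
        [disjoint S & T],
        has_spanning is_star (induced S)
      & has_spanning is_biclique (induced T)].

(* The model of computation is the random access machine of Cook and Reckhow:
   registers X_0, X_1, ... holding natural numbers, a read-only input sequence,
   and a finite program, each executed instruction costing one step.  There is
   no multiplication, so beyond the constants and the input the maximal bit
   length of the registers grows by at most one per step, and polynomial time is
   the same as for Turing machines. *)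
Inductive instr :=
| IConst of nat & nat          (* IConst i b  :  X_i <- b                     *)
| IAdd of nat & nat & nat      (* IAdd i j k  :  X_i <- X_j + X_k             *)
| ISub of nat & nat & nat      (* ISub i j k  :  X_i <- max (X_j - X_k) 0     *)
| IFetch of nat & nat          (* IFetch i j  :  X_i <- X_(X_j)               *)
| IStore of nat & nat          (* IStore i j  :  X_(X_i) <- X_j               *)
| IJump of nat & nat           (* IJump l j   :  go to line l if X_j > 0      *)
| IRead of nat.                (* IRead i     :  X_i <- next input, 0 if none *)

Definition program := seq instr.

Record config := Config {
  pc : nat;
  reg : nat -> nat;
  input : seq nat
}.

Definition exec (a : instr) (c : config) : config :=
  let: Config l X w := c in
  match a with
  | IConst i b => Config l.+1 [eta X with i |-> b] w
  | IAdd i j k => Config l.+1 [eta X with i |-> X j + X k] w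
  | ISub i j k => Config l.+1 [eta X with i |-> X j - X k] w
  | IFetch i j => Config l.+1 [eta X with i |-> X (X j)] w
  | IStore i j => Config l.+1 [eta X with X i |-> X j] w
  | IJump m j => Config (if 0 < X j then m else l.+1) X w
  | IRead i => Config l.+1 [eta X with i |-> head 0 w] (behead w)
  end.

(* A program halts when control leaves it; halted configurations are fixed by
   [step], so [iter t] below describes the state after at most t instructions. *)
Definition step (P : program) (c : config) : config :=
  if onth P (pc c) is Some a then exec a c else c.

Definition halted (P : program) (c : config) : Prop := size P <= pc c.

Definition init (w : seq nat) : config := Config 0 (fun=> 0) w.

Definition run (P : program) (w : seq nat) (t : nat) : config :=
  iter t (step P) (init w).

(* X_0 > 0 on halting means yes. *)
Definition decides_within (P : program) (w : seq nat) (t : nat) (Q : Prop) :=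
  halted P (run P w t) /\ (0 < reg (run P w t) 0 <-> Q).

(* The number of vertices, then the adjacency matrix row by row. *)
Definition encode (G : sgraph) : seq nat :=
  #|G| :: [seq nat_of_bool (adj x y) | x <- enum G, y <- enum G].

(* A promise problem: nothing is required of the program on graphs outside D. *)
Definition poly_time_decidable_on (D Q : sgraph -> Prop) : Prop :=
  exists (P : program) (p : {poly nat}), forall G : sgraph, D G ->
    decides_within P (encode G) (horner p (size (encode G))) (Q G).

(* Main.v *)
Require Import Defs.
From mathcomp Require Import all_boot all_order all_algebra.
From mathcomp Require Import zify.

(* Let c be the centre of the star and N the set of vertices other than c that
   are not adjacent to c.  Everything outside N + c may be moved to the star, so
   the question is whether some T containing N but not c induces a spanning
   biclique, i.e. is a singleton or disconnected in the complement graph.  N is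
   not empty, as otherwise G has a spanning star and is in BP1.  Hence such a T
   exists iff for some vertex b some v in N is not the end of a walk b, w1, ...,
   v of positive length in the complement graph with all wi in N: if N + b is
   disconnected such a v exists, and requiring positive length covers the case
   N = {b}.  For every c and b the machine saturates a marking of N by n rounds
   over all pairs of vertices. *)

Set Implicit Arguments.
Unset Strict Implicit.
Unset Printing Implicit Defensive.

(** * Spanning stars and bicliques *)

Lemma isomorphic_K1 (H : sgraph) (c : H) : (forall x, x = c) -> isomorphic H K1.
Proof.
move=> Hc; exists (fun=> tt); last first.
  by move=> x y; rewrite (Hc x) (Hc y) !adj_irr.
exists (fun=> c) => [x|[]] //; exact/esym/Hc.
Qed.

(** Keeping only the edges with exactly one end in [A] gives the complete bipartite graph; [a] and
    [b] serve as the defaults of [enum_rank_in]. *)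
Lemma join_spanning (G : sgraph) (A : {set G}) a b : a \in A -> b \notin A ->
  (forall x y, x \in A -> y \notin A -> adj x y) ->
  exists H : subgraph G,
    sub_verts H = [set: G] /\ isomorphic H (Kbip #|A| #|~: A|).
Proof.
move=> aA bA joined.
pose E := [rel x y | (x \in A) (+) (y \in A)].
have Esym : symmetric E by move=> x y; rewrite /= addbC.
have EP x y : E x y -> [&& x \in [set: G], y \in [set: G] & adj x y].
  rewrite !inE /=; case: (boolP (x \in A)) => [xA yA|xA /= yA].
    exact: joined.
  by rewrite adj_sym joined.
have bA' : b \in ~: A by rewrite inE.
pose H := Subgraph Esym EP; exists H; split=> //.
pose f (x : H) : Kbip #|A| #|~: A| :=
  if val x \in A then inl (enum_rank_in aA (val x))
  else inr (enum_rank_in bA' (val x)).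
pose g (u : Kbip #|A| #|~: A|) : H :=
  match u with
  | inl i => exist _ (enum_val i) (in_setT _)
  | inr j => exist _ (enum_val j) (in_setT _)
  end.
exists f; first exists g.
- move=> x; apply: val_inj; rewrite /f.
  case: ifP => xA /=; rewrite enum_rankK_in //.
  by rewrite inE xA.
- case=> i; rewrite /f /=; have := enum_valP i.
    by move->; rewrite enum_valK_in.
  by rewrite inE => /negPf->; rewrite enum_valK_in.
move=> x y; rewrite /f /= /subgraph_adj /=.
by case: (val x \in A); case: (val y \in A).
Qed.

Lemma star_spanning (G : sgraph) (c : G) :
  (forall x, x != c -> adj c x) -> has_spanning is_star G.
Proof.
move=> Hc.
have [[x xc]|all_c] := altP (@existsP _ (fun x => x != c)); last first.
  have Esym : symmetric [rel x y : G | false] by [].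
  have EP (x y : G) : [rel x y : G | false] x y ->
    [&& x \in [set: G], y \in [set: G] & adj x y] by [].
  pose H := Subgraph Esym EP; exists H; split=> //; left.
  apply: (isomorphic_K1 (c := exist _ c (in_setT c) : H)) => x.
  apply: val_inj => /=; apply/eqP; apply: contraR all_c => xc.
  by apply/existsP; exists (val x).
have [||y z /set1P->|H [HV Hiso]] := @join_spanning G [set c] c x.
- exact: set11.
- by rewrite inE.
- by rewrite inE; apply: Hc.
exists H; split=> //; right; exists #|~: [set c]|; split.
  by apply/card_gt0P; exists x; rewrite !inE.
by rewrite -[X in Kbip X _](cards1 c).
Qed.

Lemma is_star_biclique H : is_star H -> is_biclique H.
Proof. by case=> [|[n [n_gt0 ?]]]; [left | right; exists 1, n]. Qed.

Lemma is_star_spanning G : has_spanning is_star G -> has_spanning is_biclique G.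
Proof. by case=> H [HV /is_star_biclique]; exists H. Qed.

Lemma universal_BP1 (G : sgraph) (c : G) :
  (forall x, x != c -> adj c x) -> BP 1 G.
Proof.
case/star_spanning => H [HV /is_star_biclique Hb].
by exists 1, (fun=> H); split=> // x; exists ord0; rewrite HV inE.
Qed.

Lemma biclique_spanning (G : sgraph) (A : {set G}) a b :
  a \in A -> b \notin A ->
  (forall x y, x \in A -> y \notin A -> adj x y) -> has_spanning is_biclique G.
Proof.
move=> aA bA /(join_spanning aA bA)[H [HV Hiso]]; exists H; split=> //; right.
exists #|A|, #|~: A|; split=> //; apply/card_gt0P; first by exists a.
by exists b; rewrite inE.
Qed.

(** The sides are [T :&: A] and [T :\: A], so [A] may extend beyond [T]. *)
Lemma biclique_spanning_induced (G : sgraph) (T A : {set G}) a b :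
  a \in T -> a \in A -> b \in T -> b \notin A ->
  (forall x y, x \in T -> y \in T -> x \in A -> y \notin A -> adj x y) ->
  has_spanning is_biclique (induced T).
Proof.
move=> aT aA bT bA joined.
apply: (@biclique_spanning (induced T) [set x | val x \in A]
  (exist _ a aT) (exist _ b bT)); rewrite ?inE // => x y.
by rewrite !inE; apply: joined; apply: valP.
Qed.

Lemma spanning_K1_eq (G : sgraph) (H : subgraph G) :
  sub_verts H = [set: G] -> isomorphic H K1 -> exists c : G, forall x, x = c.
Proof.
move=> HV [f [g fK gK] _]; exists (val (g tt)) => x.
have xH : x \in sub_verts H by rewrite HV inE.
by rewrite -[LHS]/(val (exist _ x xH : H)) -(fK (exist _ x xH)); case: (f _).
Qed.

Lemma spanning_Kbip_join (G : sgraph) (H : subgraph G) m n :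
  sub_verts H = [set: G] -> isomorphic H (Kbip m n) ->
  exists (a : 'I_m -> G) (b : 'I_n -> G),
    (forall x, (exists i, x = a i) \/ exists j, x = b j) /\
    forall i j, adj (a i) (b j).
Proof.
move=> HV [f [g fK gK] fE].
exists (fun i => val (g (inl i))), (fun j => val (g (inr j))); split=> [x|i j].
  have xH : x \in sub_verts H by rewrite HV inE.
  have := fK (exist _ x xH); case: (f _) => i E; [left|right]; exists i;
    by rewrite E.
have := fE (g (inl i)) (g (inr j)); rewrite !gK /= => /esym.
by rewrite /subgraph_adj => /sub_edgeP/and3P[].
Qed.

Lemma star_center (G : sgraph) (S : {set G}) :
  has_spanning is_star (induced S) ->
  exists2 c, c \in S & forall x, x \in S -> x != c -> adj c x.
Proof.
case=> H [HV []].
  case/(spanning_K1_eq HV) => c all_c; exists (val c); first exact: valP.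
  by move=> x xS; rewrite -(all_c (exist _ x xS)) eqxx.
case=> n [n_gt0 /(spanning_Kbip_join HV)[a [b [ab_cover ab]]]].
exists (val (a ord0)); first exact: valP.
move=> x xS; have [[i]|[j Ej] _] := ab_cover (exist _ x xS).
  by rewrite (ord1 i) => <-; rewrite eqxx.
by have := ab ord0 j; rewrite -Ej.
Qed.

Lemma biclique_sides (G : sgraph) (T : {set G}) :
  has_spanning is_biclique (induced T) ->
  (exists t, T = [set t]) \/
  exists A B : {set G}, [/\ A != set0, B != set0, T = A :|: B &
    forall x y, x \in A -> y \in B -> adj x y].
Proof.
case=> H [HV []].
  case/(spanning_K1_eq HV) => t all_t; left; exists (val t).
  apply/setP=> x; rewrite inE; apply/idP/eqP => [xT|->]; last exact: valP.
  by rewrite -(all_t (exist _ x xT)).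
case=> m [n [m_gt0 n_gt0 /(spanning_Kbip_join HV)[a [b [ab_cover ab]]]]]; right.
exists [set val (a i) | i : 'I_m], [set val (b j) | j : 'I_n]; split.
- by apply/set0Pn; exists (val (a (Ordinal m_gt0))); apply: imset_f.
- by apply/set0Pn; exists (val (b (Ordinal n_gt0))); apply: imset_f.
- apply/setP=> x; rewrite inE; apply/idP/orP => [xT|].
    have [[i E]|[j E]] := ab_cover (exist _ x xT); [left|right]; apply/imsetP.
      by exists i => //; rewrite -E.
    by exists j => //; rewrite -E.
  by case=> /imsetP[i _ ->]; [exact: valP (a i) | exact: valP (b i)].
by move=> x y /imsetP[i _ ->] /imsetP[j _ ->]; apply: ab.
Qed.

(** * Partitions and certificates in the complement graph *)

Definition nonadj (G : sgraph) : rel G := fun x y => (x != y) && ~~ adj x y.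

(** Any set [B] that contains the first steps from [b] and is closed under further steps can replace
    the set of ends of walks, so the graph argument involves no walks. *)
Definition certificate (G : sgraph) :=
  exists (c b v : G) (B : {set G}), [/\ nonadj c v, v \notin B,
    forall y, nonadj c y -> nonadj b y -> y \in B &
    forall x y, x \in B -> nonadj c y -> nonadj x y -> y \in B].

Lemma nonadj_sym G : symmetric (@nonadj G).
Proof. by move=> x y; rewrite /nonadj eq_sym adj_sym. Qed.

Lemma partition_certificate G :
  ~ BP 1 G -> star_biclique_partition G -> certificate G.
Proof.
move=> nBP [S [T [ST dST /star_center[c cS Sc] /biclique_sides HT]]].
have NT x : nonadj c x -> x \in T.
  move=> /andP[cx ncx]; have := in_setT x; rewrite -ST inE => /orP[xS|//].
  by rewrite Sc // eq_sym in ncx.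
have [v cv] : exists v, nonadj c v.
  apply/existsP; apply: contra_notT nBP => /existsPn no_v.
  apply: (@universal_BP1 _ c) => x; rewrite eq_sym => cx; have := no_v x.
  by rewrite /nonadj cx negbK.
case: HT => [[t Tt]|].
  (* All non-neighbours of [c] lie in [[set t]] and [nonadj t t] fails, so no walk leaves [t]. *)
  exists c, t, v, set0; split=> // [|y /NT|x y]; rewrite ?inE //.
  by rewrite Tt inE => /eqP->; rewrite /nonadj eqxx.
case=> A [B [A0 B0 TAB AB]].
wlog vA : A B A0 B0 TAB AB / v \in A.
  have := NT v cv; rewrite TAB inE => /orP[vA|vB] H; first exact: (H A B).
  by apply: (H B A B0 A0 (setUC A B) _ vB) => x y xB yA; rewrite adj_sym AB.
have [b bB] := set0Pn _ B0.
(* A complement edge from [B] to a vertex of [T] stays in [B], since [A] and [B] are completely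
   joined. *)
have B_closed x y : x \in B -> nonadj c y -> nonadj x y -> y \in B.
  move=> xB /NT; rewrite TAB inE => /orP[yA|//] /andP[_].
  by rewrite adj_sym AB.
exists c, b, v, B; split=> //; last by move=> y; apply: B_closed.
by apply: contraL cv => vB; have := AB v v vA vB; rewrite adj_irr.
Qed.

(** If [v] differs from [b], take [b |: N] as [T], with [b |: B] cutting out one side. If [v] is
    [b], then [b] is adjacent to all the rest of [N], and [T] is [N]. *)
Lemma certificate_partition G : certificate G -> star_biclique_partition G.
Proof.
move=> [c [b [v [B [cv vB Bb B_closed]]]]].
have cc : nonadj c c = false by rewrite /nonadj eqxx.
(* Otherwise [v] would be a non-neighbour of [b], hence in [B]. *)
have bc : b != c by apply: contraNneq vB => bc; apply: Bb; rewrite ?bc.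
pose N := [set x | nonadj c x].
suff [T [NT cT HT]] : exists T : {set G},
    [/\ N \subset T, c \notin T & has_spanning is_biclique (induced T)].
  exists (~: T), T; split=> //; first by rewrite setUC setUCr.
    by rewrite disjoints_subset.
  have cT' : c \in ~: T by rewrite inE.
  apply: (@star_spanning (induced (~: T)) (exist _ c cT')) => x xc.
  have := valP x; rewrite inE; apply: contraR => ncx; apply: (subsetP NT).
  rewrite inE /nonadj ncx andbT; apply: contraNneq xc => cx.
  by apply/eqP/val_inj.
have adjE x y (A : {set G}) : x \in A -> y \notin A -> ~~ nonadj x y -> adj x y.
  move=> xA yA; rewrite negb_and !negbK => /orP[/eqP xy|//].
  by rewrite -xy xA in yA.
have [Ev|vb] := eqVneq v b; last first.
  exists (b |: N); split; first exact: subsetUr.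
    by rewrite !inE eq_sym negb_or bc cc.
  apply: (@biclique_spanning_induced _ _ (b |: B) b v);
    rewrite ?inE ?eqxx ?cv ?orbT //.
    by rewrite negb_or vb.
  move=> x y _ yT xA yA; apply: (adjE _ _ _ xA yA); apply: contra yA => xy.
  move: yT xA; rewrite !inE => /predU1P[->|cy]; first by rewrite eqxx.
  case/predU1P=> [xb|xB]; first by rewrite Bb ?orbT // -xb.
  by rewrite (B_closed x) ?orbT.
exists N; split=> //; first by rewrite inE cc.
rewrite {}Ev in cv vB.
have [w /andP[cw wb]|no_w] := pickP [pred w | nonadj c w & w != b].
  apply: (@biclique_spanning_induced _ _ [set b] b w); rewrite ?inE ?eqxx //.
  move=> x y _ yN xA yA; apply: (adjE _ _ _ xA yA); apply: contra vB => xy.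
  rewrite !inE in yN xA; rewrite (eqP xA) in xy.
  (* A non-neighbour [y] of [b] in [N] lies in [B], and the step back from [y] would put [b] in
     [B]. *)
  by apply: (B_closed y); rewrite // 1?nonadj_sym //; apply: Bb.
have bN : b \in N by rewrite inE.
apply: is_star_spanning.
apply: (@star_spanning (induced N) (exist _ b bN)) => x.
have := no_w (val x); rewrite /= => /negbT.
have := valP x; rewrite inE => -> /=.
by rewrite negbK => /eqP xb /eqP[]; apply: val_inj.
Qed.


(** * Execution of code without jumps *)

Definition code_at (P : program) (l : nat) (a : program) :=
  forall i, i < size a -> onth P (l + i) = onth a i.

Lemma code_at_cat P l a b :
  code_at P l (a ++ b) -> code_at P l a /\ code_at P (l + size a) b.
Proof.
move=> H; split=> i lt_i.
  by rewrite H ?onth_cat ?lt_i // size_cat ltn_addr.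
rewrite -addnA H ?size_cat ?ltn_add2l // onth_cat ltnNge leq_addr /=.
by rewrite addKn.
Qed.

Definition straight (a : instr) := if a is IJump _ _ then false else true.

Lemma pc_exec_straight a c : straight a -> pc (exec a c) = (pc c).+1.
Proof. by case: c => l X w; case: a. Qed.

Lemma run_straight P a c : all straight a -> code_at P (pc c) a ->
  iter (size a) (step P) c = foldl (fun d i => exec i d) c a.
Proof.
elim: a c => [|i a IH] c //= /andP[si sa] Pa.
rewrite -iterS iterSr {2}/step; have := Pa 0 isT; rewrite addn0 /= => ->.
apply: IH => // j lt_j; rewrite pc_exec_straight // addSnnS.
by rewrite (Pa j.+1).
Qed.

(** * Composition of code fragments and loops *)

Section Programs.

Variables (n : nat) (n_gt0 : 0 < n).

Record mstate := MState { ram : nat -> nat; acc : nat; inp : seq nat }.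

(* Register 0 is the accumulator, 1 holds [n], 2 to 4 are scratch; the memory
   [ram] starts at register 15.  Its first [n] cells are the marks and the
   matrix follows row by row.  The loop at depth [d] keeps its index [k] in
   register [2d + 5] and, as there is no multiplication, the address
   [15 + n + k * n] of row [k] of the matrix in register [2d + 6]. *)
Definition ix d := d.*2 + 5.
Definition px d := d.*2 + 6.

(** Scratch registers and the registers of loops deeper than [e] are left free, so that code may
    overwrite them. *)
Definition rep (l : nat) (e : seq nat) (s : mstate) (c : config) : Prop :=
  [/\ pc c = l, input c = inp s, reg c 0 = acc s & reg c 1 = n] /\
  (forall a, reg c (15 + a) = ram s a) /\
  (forall d, d < size e ->
     reg c (ix d) = nth 0 e d /\ reg c (px d) = 15 + (n + nth 0 e d * n)).

(* Code at loop depth [D], a function of its own address because jumps are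
   absolute, implements [f] in at most [t] steps; [e] lists the indices of the
   enclosing loops, outermost first. *)
Definition computes (D : nat) (code : nat -> program) (t : nat)
    (f : seq nat -> mstate -> mstate) :=
  forall P l e s c, size e = D -> code_at P l (code l) -> rep l e s c ->
  exists2 k, k <= t & rep (l + size (code l)) e (f e s) (iter k (step P) c).

Definition cseq (c1 c2 : nat -> program) l : program :=
  c1 l ++ c2 (l + size (c1 l)).

Lemma computes_seq D c1 c2 t1 t2 f1 f2 :
  computes D c1 t1 f1 -> computes D c2 t2 f2 ->
  computes D (cseq c1 c2) (t1 + t2)
    (fun e s => f2 e (f1 e s)).
Proof.
move=> H1 H2 P l e s c sz /code_at_cat[P1 P2] /(H1 P) [] // k1 le1 r1.
have [k2 le2 r2] := H2 P _ _ _ _ sz P2 r1.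
exists (k2 + k1); first by rewrite addnC leq_add.
by rewrite size_cat addnA iterD.
Qed.

Definition for_loop (f : nat -> mstate -> mstate) (s : mstate) :=
  foldl (fun s k => f k s) s (iota 0 n).

(* The test comes after the body, so this is correct only for [0 < n]. *)
Definition loop D (body : nat -> program) l : program :=
  [:: IConst (ix D) 0; IConst (px D) 15; IAdd (px D) (px D) 1] ++
  body (l + 3) ++
  [:: IConst 2 1; IAdd (ix D) (ix D) 2; IAdd (px D) (px D) 1;
      ISub 2 1 (ix D); IJump (l + 3) 2].

Lemma rep_belast l e k s c : rep l (rcons e k) s c -> rep l e s c.
Proof.
move=> [? [? E]]; do 2!split=> //; move=> d ltd.
by have := E d; rewrite size_rcons nth_rcons ltd ltnS ltnW // => /(_ isT).
Qed.

(** Five nested loops occupy registers 5 to 14, just below the memory; hence the bound on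
    [size e]. *)
Lemma rep_rcons l l' e k s c X : size e < 5 -> rep l e s c ->
  (forall x, x != ix (size e) -> x != px (size e) -> x != 2 -> X x = reg c x) ->
  X (ix (size e)) = k -> X (px (size e)) = 15 + (n + k * n) ->
  rep l' (rcons e k) s (Config l' X (input c)).
Proof.
move=> lt5 [[pcE inE accE nE] [memE eE]] XE ixE pxE; split; last split.
- by split=> //=; rewrite XE /ix /px //; lia.
- by move=> a /=; rewrite XE // /ix /px; lia.
move=> d /=; rewrite size_rcons nth_rcons ltnS leq_eqVlt.
case: ltngtP => //= [ltd _|-> _ //]; rewrite !XE; first exact: eE;
  by rewrite /ix /px; lia.
Qed.

(** Three instructions set up the loop; each of the [n] rounds costs the body and the five
    instructions after it. *)
Lemma computes_loop D body t f : D < 5 -> computes D.+1 body t f ->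
  computes D (loop D body) (3 + n * (t + 5))
    (fun e => for_loop (fun k => f (rcons e k))).
Proof.
move=> ltD Hb P l e s c sz /code_at_cat[P0 /code_at_cat[Pb P1]] r.
set head := [:: _; _; _] in P0 Pb P1.
set body_end := _ + size (body _) in P1; set tail := [:: _, _, _, _ & _] in P1.
have regD : ((ix D == 2) = false) * ((px D == 2) = false) *
    ((px D == ix D) = false) * ((1 == ix D) = false) * ((1 == px D) = false) *
    ((ix D == px D) = false) * (ix D == ix D) * (px D == px D).
  by rewrite !eqxx /ix /px; do !split; lia.
have rep_tail k s' c' : rep body_end (rcons e k) s' c' ->
    if k.+1 < n then rep (l + 3) (rcons e k.+1) s' (iter 5 (step P) c')
    else rep (body_end + 5) e s' (iter 5 (step P) c').
  move=> rc; have r0 := rep_belast rc; case: rc.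
  move=> [pc_c in_c _ n_c] [_ e_c].
  have [|ix_k px_k] := e_c (size e); first by rewrite size_rcons.
  rewrite nth_rcons ltnn eqxx sz in ix_k px_k.
  (* The first four instructions are straight-line code; the jump is executed separately. *)
  rewrite (iterD 1 4) -[X in iter X _ c']/(size (take 4 tail)).
  rewrite run_straight //; last by move=> [|[|[|[|//]]]] _; rewrite pc_c P1.
  move: {pc_c} P1 (pc_c) => /(_ 4 isT).
  case: c' {in_c e_c} n_c ix_k px_k r0 => pc' X w /= n_c ix_k px_k r0 Pj pc_c.
  rewrite addn4 /= in Pj; rewrite /step /= pc_c.
  rewrite Pj /= !regD /= ix_k px_k n_c subn_gt0 addn1.
  set X' := (Z in Config _ Z w).
  have r' l' : rep l' (rcons e k.+1) s' (Config l' X' w).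
    apply: (rep_rcons l' _ r0); rewrite ?sz /X' //= ?regD //; last first.
      by rewrite mulSn; lia.
    by move=> x /negPf-> /negPf-> /negPf->.
  case: (k.+1 < n); first exact: r'.
  by rewrite (addnS _ 4) addn4; apply: rep_belast (r' _).
(* [j] counts the rounds left after the current one, whose index is [k]. *)
have loop_inv j : forall k s c, k + j.+1 = n -> rep (l + 3) (rcons e k) s c ->
    exists2 i, i <= j.+1 * (t + 5) &
    rep (body_end + 5) e
      (foldl (fun s k => f (rcons e k) s) s (iota k j.+1)) (iter i (step P) c).
  have szk k : size (rcons e k) = D.+1 by rewrite size_rcons sz.
  elim: j => [|j IH] k s' c' eq_n /(Hb P _ _ _ _ (szk k) Pb) [i le_i /rep_tail].
    rewrite -{1}eq_n addn1 ltnn => r'.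
    by exists (5 + i); rewrite ?iterD //; lia.
  have -> : k.+1 < n by lia.
  move=> /IH [|i' le_i' r']; first lia.
  by exists (i' + (5 + i)); rewrite ?iterD //; lia.
have r3 : rep (l + 3) (rcons e 0) s (iter 3 (step P) c).
  have [[pc_c _ _ n_c] _] := r.
  rewrite -[X in iter X _ c]/(size head) run_straight //; last by rewrite pc_c.
  rewrite -pc_c; case: c r n_c {pc_c} => pc' X w r /= n_c; rewrite !regD addn3.
  apply: rep_rcons r _ _ _; rewrite ?sz //= ?regD ?n_c //.
    by move=> x /negPf-> /negPf->.
  by rewrite mul0n addn0.
have [i le_i r_i] := loop_inv n.-1 0 _ _ ltac:(lia) r3.
rewrite prednK // in le_i; exists (i + 3); first by rewrite addnC leq_add2l.
move: r_i; rewrite prednK // iterD /for_loop /loop !size_cat /= /body_end.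
by rewrite !addnA.
Qed.

Lemma computes_straight D code f : all straight code ->
  (forall l e s X w, size e = D -> rep l e s (Config l X w) ->
     rep (l + size code) e (f e s)
       (foldl (fun d i => exec i d) (Config l X w) code)) ->
  computes D (fun=> code) (size code) f.
Proof.
move=> st H P l e s [l' X w] sz Pl r; exists (size code) => //.
have [[/= El _ _ _] _] := r; rewrite -El in r Pl *.
by rewrite run_straight //; apply: H.
Qed.

(** Two truncated subtractions give the minimum, which the machine uses as conjunction. *)
Lemma minn_sub x y : x - (x - y) = minn x y. Proof. lia. Qed.

Lemma ram_neq k a : k < 15 -> (15 + a == k) = false.
Proof. by move=> ?; apply/eqP; lia. Qed.

(** The registers other than the accumulator and the memory that [rep] may constrain. *)
Definition kept x := (x == 1) || (4 < x < 15).

Lemma kept_neq x : kept x ->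
  (forall a, (x == 15 + a) = false) *
  (((x == 0) = false) * ((x == 2) = false) *
   ((x == 3) = false) * ((x == 4) = false)).
Proof.
by rewrite /kept => kx; split=> [a|]; last do !split; apply/eqP; lia.
Qed.

Lemma rep_update l l' e s c s' X : rep l e s c -> size e <= 5 ->
  (forall x, kept x -> X x = reg c x) -> X 0 = acc s' ->
  (forall a, X (15 + a) = ram s' a) -> rep l' e s' (Config l' X (inp s')).
Proof.
move=> [[_ _ _ En] [_ Ee]] le5 XE X0 Xmem; split.
  by split=> //=; rewrite XE.
split=> // d ltd /=; rewrite !XE ?/kept ?/ix ?/px; first exact: Ee; lia.
Qed.

(** * Basic code fragments *)

Definition cell x y := n + (x * n + y).

(* A truth value is a number, true when positive: [minn] is conjunction and
   [+] is disjunction.  Matrix entries are 0 or 1, marks may be larger. *)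
Definition init_code :=
  [:: IAdd 2 (px 1) (ix 2); IFetch 2 2; IAdd 3 (px 0) (ix 2); IFetch 3 3;
      ISub 3 2 3; ISub 2 2 3; IConst 3 15; IAdd 3 3 (ix 2); IStore 3 2].

(** The old mark is overwritten, so the loop over [v] also erases the marks left by the previous
    pair [c], [b]. *)
Definition init_mark (e : seq nat) s :=
  let: (c, b, v) := (nth 0 e 0, nth 0 e 1, nth 0 e 2) in
  MState [eta ram s with v |-> minn (ram s (cell b v)) (ram s (cell c v))]
    (acc s) (inp s).

Lemma computes_init : computes 3 (fun=> init_code) 9 init_mark.
Proof.
apply: computes_straight => // l e s X w sz r.
have [[_ /= Ew Eacc En] [Eram Ee]] := r.
have [] := Ee 0; rewrite ?sz // => E0 P0.
have [] := Ee 1; rewrite ?sz // => E1 P1.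
have [] := Ee 2; rewrite ?sz // => E2 P2.
rewrite P0 P1 E2 -!addnA !ram_neq //= !Eram !minn_sub Ew.
rewrite [X in Config X](_ : _ = l + 9); last lia.
apply: rep_update r _ _ _ _; rewrite ?sz //=.
- by move=> x /kept_neq-E; rewrite !E.
- by move=> a; rewrite eqn_add2l Eram.
Qed.

Definition step_code :=
  [:: IAdd 2 (px 3) (ix 4); IFetch 2 2; IAdd 3 (px 0) (ix 4); IFetch 3 3;
      ISub 3 2 3; ISub 2 2 3; IConst 3 15; IAdd 4 3 (ix 3); IFetch 4 4;
      ISub 4 2 4; ISub 2 2 4; IAdd 3 3 (ix 4); IFetch 4 3; IAdd 2 2 4;
      IStore 3 2].

Definition step_mark (e : seq nat) s :=
  let: (c, u, v) := (nth 0 e 0, nth 0 e 3, nth 0 e 4) in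
  let x := minn (minn (ram s (cell u v)) (ram s (cell c v))) (ram s u) in
  MState [eta ram s with v |-> x + ram s v] (acc s) (inp s).

Lemma computes_step : computes 5 (fun=> step_code) 15 step_mark.
Proof.
apply: computes_straight => // l e s X w sz r.
have [[_ /= Ew Eacc En] [Eram Ee]] := r.
have [] := Ee 0; rewrite ?sz // => E0 P0.
have [] := Ee 3; rewrite ?sz // => E3 P3.
have [] := Ee 4; rewrite ?sz // => E4 P4.
rewrite P0 P3 E3 E4 -!addnA !ram_neq //= !Eram !minn_sub Ew.
rewrite [X in Config X](_ : _ = l + 15); last lia.
apply: rep_update r _ _ _ _; rewrite ?sz //=.
- by move=> x /kept_neq-E; rewrite !E.
- by move=> a; rewrite eqn_add2l Eram.
Qed.

Definition test_code :=
  [:: IAdd 2 (px 0) (ix 2); IFetch 2 2; IConst 3 15; IAdd 3 3 (ix 2);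
      IFetch 3 3; ISub 2 2 3; IAdd 0 0 2].

(** For matrix entries 0 and 1, the truncated difference is positive exactly when the entry is 1 and
    the vertex is unmarked. *)
Definition test_mark (e : seq nat) s :=
  MState (ram s)
    (acc s + (ram s (cell (nth 0 e 0) (nth 0 e 2)) - ram s (nth 0 e 2)))
    (inp s).

Lemma computes_test : computes 3 (fun=> test_code) 7 test_mark.
Proof.
apply: computes_straight => // l e s X w sz r.
have [[_ /= Ew Eacc En] [Eram Ee]] := r.
have [] := Ee 0; rewrite ?sz // => E0 P0.
have [] := Ee 2; rewrite ?sz // => E2 P2.
rewrite P0 E2 -!addnA !ram_neq //= !Eram Ew.
rewrite [X in Config X](_ : _ = l + 7); last lia.
apply: rep_update r _ _ _ _; rewrite ?sz //=.
- by move=> x /kept_neq-E; rewrite !E.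
- by rewrite Eacc.
Qed.

(* The entry stored is 0 on the diagonal, where [x - y + (y - x)] is 0, and the
   negation of the adjacency read elsewhere. *)
Definition read_code :=
  [:: IRead 2; IConst 3 1; ISub 2 3 2; ISub 3 (ix 0) (ix 1);
      ISub 4 (ix 1) (ix 0); IAdd 3 3 4; ISub 3 2 3; ISub 2 2 3;
      IAdd 3 (px 0) (ix 1); IStore 3 2].

Definition read_cell (e : seq nat) s :=
  let: (x, y) := (nth 0 e 0, nth 0 e 1) in
  MState
    [eta ram s with cell x y |-> minn (1 - head 0 (inp s)) (x - y + (y - x))]
    (acc s) (behead (inp s)).

Lemma computes_read : computes 2 (fun=> read_code) 10 read_cell.
Proof.
apply: computes_straight => // l e s X w sz r.
have [[_ /= Ew Eacc En] [Eram Ee]] := r.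
have [] := Ee 0; rewrite ?sz // => E0 P0.
have [] := Ee 1; rewrite ?sz // => E1 P1.
rewrite P0 E0 E1 -!addnA !minn_sub Ew.
rewrite [X in Config X](_ : _ = l + 10); last lia.
apply: rep_update r _ _ _ _; rewrite ?sz //=.
- by move=> x /kept_neq-E; rewrite !E.
- by move=> a; rewrite eqn_add2l Eram.
Qed.

(** * Loop invariants and reading the matrix *)

Lemma for_loop_ind (I : nat -> mstate -> Prop) f s : I 0 s ->
  (forall k s', k < n -> I k s' -> I k.+1 (f k s')) -> I n (for_loop f s).
Proof.
move=> I0 IS.
suff H m : m <= n -> I m (foldl (fun s k => f k s) s (iota 0 m)) by apply: H.
elim: m => [|m IH] // ltm.
by rewrite -addn1 iotaD foldl_cat addn1 /= add0n; apply: IS (IH (ltnW ltm)).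
Qed.

Lemma flat_inj x y x' y' : y < n -> y' < n -> x' * n + y' = x * n + y ->
  x' = x /\ y' = y.
Proof.
move=> lty lty' E; have := congr1 (divn^~ n) E.
by rewrite !divnMDl // !divn_small // !addn0 => Ex; move: E; rewrite Ex; lia.
Qed.

Definition for2 (f : nat -> nat -> mstate -> mstate) :=
  for_loop (fun x => for_loop (f x)).

Definition read_all := for2 (fun x y => read_cell [:: x; y]).

(** Exhausted input reads as 0, which is also the default given to [nth], so [w] may have any
    length. *)
Lemma read_all_correct w (s := read_all (MState (fun=> 0) 0 w)) :
  acc s = 0 /\ forall x y, x < n -> y < n ->
    ram s (cell x y) = minn (1 - nth 0 w (x * n + y)) (x - y + (y - x)).
Proof.
(* [k] counts the cells filled in row-major order; the outer loop uses this invariant at multiples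
   of [n]. *)
pose I k s := [/\ acc s = 0, inp s = drop k w &
  forall x y, y < n -> x * n + y < k ->
    ram s (cell x y) = minn (1 - nth 0 w (x * n + y)) (x - y + (y - x))].
suff [acc0 _ H] : I (n * n) (read_all (MState (fun=> 0) 0 w)).
  by split=> // x y ltx lty; apply: H => //; nia.
apply: (for_loop_ind (I := fun x => I (x * n))); first by split; rewrite ?drop0.
move=> x s' ltx Is; rewrite mulSn addnC.
apply: (for_loop_ind (I := fun y => I (x * n + y))); first by rewrite addn0.
move=> y {Is} {}s' lty [acc0 inpE memE]; split=> //=.
  by rewrite inpE -drop1 drop_drop add1n addnS.
move=> x' y' lty'; rewrite /cell eqn_add2l addnS ltnS leq_eqVlt.
case: eqP => /= [E _|_]; last exact: memE.
by have [-> ->] := flat_inj lty lty' E; rewrite inpE -nth0 nth_drop addn0.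
Qed.

(** * Correctness of the marking and of the search *)

Variable h : rel 'I_n.

Definition walk_rel c : rel 'I_n := [rel x y | h x y && h c y].

(** The separate first step excludes the empty walk: [b] itself is reached only if some walk returns
    to it. *)
Definition reach c b v :=
  [exists u, walk_rel c b u && connect (walk_rel c) u v].

Definition holds a s :=
  acc s = a /\ forall x y : 'I_n, ram s (cell x y) = h x y.

Lemma cell_neq x y v : v < n -> (cell x y == v) = false.
Proof. by move=> ltv; apply/eqP; rewrite /cell; lia. Qed.

Definition marked s (v : 'I_n) := 0 < ram s v.

Lemma holds_step a s (c : 'I_n) b r (u v : 'I_n) : holds a s ->
  let s' := step_mark [:: nat_of_ord c; b; r; nat_of_ord u; nat_of_ord v] s in
  holds a s' /\ forall y, marked s' y =
    marked s y || [&& y == v, marked s u & walk_rel c u v].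
Proof.
move=> [accE hE]; split; first by split=> // x y; rewrite /= cell_neq.
move=> y; rewrite /marked /= -!/(cell _ _) !hE val_eqE; case: eqP => [->|_].
  by rewrite /= addn_gt0 !leq_min !lt0b orbC andbC.
by rewrite orbF.
Qed.

Definition round (c b r : nat) :=
  for2 (fun u v => step_mark [:: c; b; r; u; v]).

(** Marks change in place, so one round may carry a mark along several edges. The new marks are
    therefore bounded above by a closed set [S] and below by one step from the old marks. *)
Lemma roundP a s (c : 'I_n) b r (S : pred 'I_n) : holds a s ->
  (forall x y, S x -> walk_rel c x y -> S y) -> (forall y, marked s y -> S y) ->
  let s' := round c b r s in
  [/\ holds a s', forall y, marked s' y -> S y,
      forall y, marked s y -> marked s' y
    & forall x y, marked s x -> walk_rel c x y -> marked s' y].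
Proof.
move=> hs S_closed S_marked.
pose I m s' := [/\ holds a s', forall y, marked s' y -> S y,
  forall y, marked s y -> marked s' y &
  forall x y : 'I_n, x * n + y < m -> marked s x -> walk_rel c x y ->
    marked s' y].
suff [hs' S' mono H] : I (n * n) (round c b r s).
  split=> // x y mx xy; apply: H mx xy.
  by have := ltn_ord x; have := ltn_ord y; nia.
apply: (for_loop_ind (I := fun x => I (x * n))) => // x s' ltx Is.
rewrite mulSn addnC.
apply: (for_loop_ind (I := fun y => I (x * n + y))); first by rewrite addn0.
move=> y {Is} {}s' lty [hs' S' mono H].
have [] := holds_step c b r (Ordinal ltx) (Ordinal lty) hs' => hs'' E.
split=> // [z|z mz|u v]; rewrite ?E.
- by case/orP=> [/S'//|/and3P[/eqP-> /S' Sx xy]]; apply: S_closed Sx xy.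
- by rewrite mono.
rewrite addnS ltnS leq_eqVlt => /orP[/eqP eq_uv|lt_uv] mu uv; last first.
  by rewrite (H u).
have [Eu Ev] := flat_inj lty (ltn_ord v) eq_uv.
have {Eu}-> : Ordinal ltx = u by apply: val_inj.
have -> : Ordinal lty = v by apply: val_inj.
by rewrite (mono u mu) uv eqxx orbT.
Qed.

Definition mark (c b : nat) s :=
  for_loop (round c b)
    (for_loop (fun v => init_mark [:: c; b; v]) s).

Lemma markP a s (c b : 'I_n) : holds a s ->
  holds a (mark c b s) /\ forall y, marked (mark c b s) y = reach c b y.
Proof.
rewrite /mark => hs; set s1 := for_loop _ s.
have [hs1 s1E] : holds a s1 /\ forall y, marked s1 y = walk_rel c b y.
  suff [? H] : holds a s1 /\
      forall y : 'I_n, y < n -> marked s1 y = walk_rel c b y.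
    by split=> // y; apply: H.
  apply: (for_loop_ind (I := fun m s' => holds a s' /\
    forall y : 'I_n, y < m -> marked s' y = walk_rel c b y)) => //.
  move=> m s' ltm [[accE hE] H].
  split=> [|y]; first by split=> // x y; rewrite /= cell_neq.
  rewrite /marked /= ltnS leq_eqVlt; case: eqP => [Ey _|_]; last exact: H.
  have -> : y = Ordinal ltm by apply: val_inj.
  by rewrite !(hE _ (Ordinal ltm)) leq_min !lt0b.
have : [/\ holds a (for_loop (round c b) s1),
  forall y, marked (for_loop (round c b) s1) y -> reach c b y &
  forall u p, walk_rel c b u -> path (walk_rel c) u p -> size p <= n ->
    marked (for_loop (round c b) s1) (last u p)].
  apply: (for_loop_ind (I := fun m s' => [/\ holds a s',
    forall y, marked s' y -> reach c b y &
    forall u p, walk_rel c b u -> path (walk_rel c) u p -> size p <= m ->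
      marked s' (last u p)])) => [|m s' ltm [hs' S' H]].
    split=> // [y|u [|//] bu _ _]; rewrite s1E // => by_.
    by apply/existsP; exists y; rewrite by_ connect0.
  have [|hs'' S'' mono next] := roundP (c := c) b m hs' _ S'.
    move=> x y /existsP[u /andP[bu ux]] xy; apply/existsP; exists u.
    by rewrite bu (connect_trans ux (connect1 xy)).
  split=> // u p bu; case/lastP: p => [_ _|p z].
    by apply: mono; apply: (H u [::]).
  rewrite rcons_path size_rcons last_rcons => /andP[up pz] ltp.
  exact: next (H u p bu up ltp) pz.
case=> hs2 sound compl; split=> // y; apply/idP/idP=> [/sound//|].
(* Without repetitions a walk has at most [n] vertices, so [n] rounds suffice. *)
case/existsP=> u /andP[bu /connectP[p up ->]]; case/shortenP: up => q uq Uq _.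
apply: compl => //; apply: ltnW.
by have := max_card (mem (u :: q)); rewrite (card_uniqP Uq) card_ord.
Qed.

Definition unreached c b v := h c v && ~~ reach c b v.

(** The accumulator acts as a disjunction over the rounds, so only its sign is tracked; [I] carries
    the other facts about the state. *)
Lemma for_loop_acc (I : nat -> mstate -> Prop) a s (f : nat -> mstate -> mstate)
    (E : pred 'I_n) : I a s ->
  (forall (k : 'I_n) a s, I a s ->
     exists2 a', I a' (f k s) & (0 < a') = (0 < a) || E k) ->
  exists2 a', I a' (for_loop f s) & (0 < a') = (0 < a) || [exists k, E k].
Proof.
move=> hs step.
have [a' hs' aE] : exists2 a', I a' (for_loop f s) &
    (0 < a') = (0 < a) || [exists k : 'I_n, (k < n) && E k].
  apply: (for_loop_ind (I := fun m s' => exists2 a', I a' s' &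
    (0 < a') = (0 < a) || [exists k : 'I_n, (k < m) && E k])).
    by exists a => //; case: existsP => [[]|]//; rewrite orbF.
  move=> m s' ltm [a1 h1 E1]; have [a2 h2 E2] := step (Ordinal ltm) _ _ h1.
  exists a2 => //; rewrite E2 E1 -orbA; congr orb.
  apply/orP/existsP=> [[/existsP[k /andP[lt_k Ek]]|Ek]|[k /andP[]]].
  - by exists k; rewrite Ek ltnW.
  - by exists (Ordinal ltm); rewrite ltnSn.
  rewrite ltnS leq_eqVlt => /orP[/eqP Ek|lt_k] EEk; [right|left].
    by rewrite (_ : Ordinal ltm = k) //; apply: val_inj.
  by apply/existsP; exists k; rewrite lt_k.
exists a' => //; rewrite aE; congr orb.
by apply: eq_existsb => k; rewrite ltn_ord.
Qed.

Definition search :=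
  for2 (fun c b s =>
    for_loop (fun v => test_mark [:: c; b; v]) (mark c b s)).

Lemma searchP s : holds 0 s ->
  (0 < acc (search s)) = [exists c, exists b, exists v, unreached c b v].
Proof.
move=> hs.
have [|a [<- _] -> //] := for_loop_acc
  (E := fun c => [exists b, exists v, unreached c b v])
  (f := fun c => for_loop (fun b s =>
    for_loop (fun v => test_mark [:: c; b; v]) (mark c b s))) hs.
move=> c a {}s {}hs; apply: for_loop_acc hs _ => b {}a {}s /(markP c b)[hs mE].
(* In the innermost loop the invariant must also retain the marks computed for [c] and [b]. *)
have [|a' [hs' _] aE] := for_loop_acc (E := unreached c b)
  (I := fun a s => holds a s /\ forall y, marked s y = reach c b y)
  (f := fun v => test_mark [:: nat_of_ord c; nat_of_ord b; v]) (conj hs mE).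
  move=> v a0 s' [[accE hE] mE'].
  set s'' := test_mark _ s'; exists (acc s'') => //.
  rewrite /= addn_gt0 accE hE /unreached -mE' /marked subn_gt0; congr orb.
  by case: (h c v); case: (ram s' v).
by exists a'.
Qed.

End Programs.

(** * The complete program and its cost *)

Definition loop_cost n t := 3 + n * (t + 5).

Definition main : nat -> program :=
  cseq (loop 0 (loop 1 (fun=> read_code)))
    (loop 0 (loop 1 (cseq
      (cseq (loop 2 (fun=> init_code))
        (loop 2 (loop 3 (loop 4 (fun=> step_code)))))
      (loop 2 (fun=> test_code))))).

Definition main_cost n :=
  let lc := loop_cost n in
  lc (lc 10) + lc (lc (lc 9 + lc (lc (lc 15)) + lc 7)).

(** The first input item, the number of vertices, goes to register 1, where [rep] expects [n]. *)
Definition prog : program := IRead 1 :: main 1.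

Lemma iter_halted P c m : halted P c -> iter m (step P) c = c.
Proof. by move=> hP; apply: iter_fix; rewrite /step onth_default. Qed.

Lemma prog_correct n (h : rel 'I_n) w t : 0 < n ->
  (forall x y : 'I_n,
     minn (1 - nth 0 w (x * n + y)) (x - y + (y - x)) = h x y) ->
  main_cost n < t ->
  halted prog (run prog (n :: w) t) /\
  (0 < reg (run prog (n :: w) t) 0) =
    [exists c, exists b, exists v, unreached h c b v].
Proof.
move=> n_gt0 hw lt_t.
have Hmain :
    computes n 0 main (main_cost n) (fun _ s => search n (read_all n s)).
  move=> P l [|//] s c _ Pl r.
  have loopC D body t f := @computes_loop n n_gt0 D body t f.
  have Hread := loopC 0 _ _ _ isT (loopC 1 _ _ _ isT (@computes_read n n_gt0)).
  have Hinit := loopC 2 _ _ _ isT (@computes_init n n_gt0).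
  have Hstep := loopC 2 _ _ _ isT (loopC 3 _ _ _ isT
    (loopC 4 _ _ _ isT (@computes_step n n_gt0))).
  have Htest := loopC 2 _ _ _ isT (@computes_test n n_gt0).
  have Hsearch := loopC 0 _ _ _ isT (loopC 1 _ _ _ isT
    (computes_seq (computes_seq Hinit Hstep) Htest)).
  exact: (computes_seq Hread Hsearch _ Pl r).
pose c0 := step prog (init (n :: w)).
have r0 : rep n 1 [::] (MState (fun=> 0) 0 w) c0 by [].
have Pm : code_at prog 1 (main 1) by [].
have [k le_k [[pcE _ accE _] _]] := Hmain prog 1 [::] _ c0 erefl Pm r0.
have hk : halted prog (iter k (step prog) c0) by rewrite /halted pcE.
(* Halted configurations are fixed, so running on up to [t] changes nothing. *)
have -> : run prog (n :: w) t = iter k (step prog) c0.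
  rewrite /run (_ : t = (t - k.+1) + k.+1); last lia.
  by rewrite iterD iterSr iter_halted.
split=> //; rewrite accE; apply: (searchP n_gt0).
have [acc0 ramE] := read_all_correct n_gt0 w.
by split=> // x y; rewrite ramE.
Qed.

(** * From the matrix back to the graph *)

Definition index_nonadj (G : sgraph) : rel 'I_#|G| :=
  fun i j => nonadj (enum_val i) (enum_val j).

(** The set of reached vertices serves as [B]; conversely, induction along a walk shows that a
    closed [B] contains every reached vertex. *)
Lemma unreached_certificate (G : sgraph) (h := @index_nonadj G) :
  [exists c, exists b, exists v, unreached h c b v] <-> certificate G.
Proof.
split.
  case/existsP=> c /existsP[b /existsP[v /andP[cv nreach]]].
  exists (enum_val c), (enum_val b), (enum_val v).
  exists [set x | reach h c b (enum_rank x)].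
  rewrite inE enum_valK; split=> // [y cy by_|x y]; rewrite !inE.
    apply/existsP; exists (enum_rank y).
    by rewrite connect0 /walk_rel /= /h /index_nonadj enum_rankK by_ cy.
  case/existsP=> u /andP[bu ux] cy xy; apply/existsP; exists u; rewrite bu /=.
  apply: connect_trans ux (connect1 _).
  by rewrite /walk_rel /= /h /index_nonadj !enum_rankK xy.
case=> c [b [v [B [cv vB Bb B_closed]]]].
apply/existsP; exists (enum_rank c); apply/existsP; exists (enum_rank b).
apply/existsP; exists (enum_rank v).
rewrite /unreached /h {1}/index_nonadj !enum_rankK cv /=.
apply: contra vB => /existsP[u /andP[/andP[bu cu] /connectP[p up Ev]]].
rewrite -[v]enum_rankK Ev; rewrite /index_nonadj !enum_rankK in bu cu.
have {bu cu Ev}: enum_val u \in B by apply: Bb.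
elim: p u up => //= y p IH u /andP[/andP[uy cy] yp] uB.
apply: IH yp _; apply: B_closed uB _ uy.
by rewrite /index_nonadj enum_rankK in cy.
Qed.

Lemma nth_allpairs (S T R : Type) (f : S -> T -> R) s t x0 y0 z0 i j :
  i < size s -> j < size t ->
  nth z0 [seq f x y | x <- s, y <- t] (i * size t + j) =
    f (nth x0 s i) (nth y0 t j).
Proof.
move=> + lt_j; elim: s i => [|x s IH] [|i] //= lt_i; rewrite nth_cat size_map.
  by rewrite lt_j (nth_map y0).
by rewrite mulSn -addnA ltnNge leq_addr /= addKn IH.
Qed.

Lemma neq_dist (x y : nat) : minn 1 (x - y + (y - x)) = (x != y).
Proof. by case: ltngtP => [?|?|->]; rewrite ?subnn //; lia. Qed.

Lemma encode_nonadj (G : sgraph) (x y : 'I_#|G|) :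
  minn (1 - nth 0 (behead (encode G)) (x * #|G| + y)) (x - y + (y - x)) =
  index_nonadj x y.
Proof.
have g : G by exact: enum_val x.
have sz : size (enum G) = #|G| by rewrite -cardE.
rewrite /= -[X in x * X]sz (nth_allpairs _ g g) ?sz //.
rewrite -!enum_val_nth /index_nonadj /nonadj (inj_eq enum_val_inj) -val_eqE /=.
case: (adj _ _); first by rewrite andbF min0n.
by rewrite andbT neq_dist.
Qed.

(** * The polynomial time bound *)

Section CostPolynomial.
Import GRing.Theory.
Local Open Scope ring_scope.

Definition loop_poly (q : {poly nat}) : {poly nat} := 3%:P + 'X * (q + 5%:P).

(** The leading 1 pays for the initial [IRead] of [prog]. *)
Definition main_poly : {poly nat} :=
  let lc := loop_poly in
  1%:P + (lc (lc 10%:P) + lc (lc (lc 9%:P + lc (lc (lc 15%:P)) + lc 7%:P))).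

End CostPolynomial.

Lemma horner_loop_poly q N : horner (loop_poly q) N = loop_cost N (horner q N).
Proof. by rewrite /loop_poly hornerD hornerM hornerX hornerD !hornerC. Qed.

(** Monotonicity is needed because the polynomial is evaluated at the input length, not at the
    number of vertices. *)
Lemma leq_loop_cost n N t u :
  n <= N -> t <= u -> loop_cost n t <= loop_cost N u.
Proof.
by move=> nN tu; rewrite leq_add2l; apply: leq_mul; rewrite ?leq_add2r.
Qed.

Lemma main_cost_lt n N : n <= N -> main_cost n < horner main_poly N.
Proof.
move=> nN.
rewrite /main_poly !(hornerD, horner_loop_poly, hornerC) ltnS /main_cost.
by repeat (apply: leq_add || apply: leq_loop_cost).
Qed.

Theorem theorem1 :
  poly_time_decidable_on (fun G : sgraph => BP 2 G /\ ~ BP 1 G)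
                         star_biclique_partition.
Proof.
exists prog, main_poly => G [_ nBP1].
(* The empty graph is covered by zero bicliques, so it is in [BP 1]. *)
have n_gt0 : 0 < #|G|.
  rewrite lt0n; apply: contra_notN nBP1 => /eqP/card0_eq G0.
  exists 0, (fun i : 'I_0 => match notF (ltn_ord i) with end).
  by split=> // [[]|x] //; have := G0 x.
have [|halts E] := prog_correct (w := behead (encode G)) n_gt0
  (@encode_nonadj G) (t := horner main_poly (size (encode G))).
  (* The input length is one more than the square of the number of vertices. *)
  apply: main_cost_lt; rewrite /= size_allpairs -cardE; nia.
split=> //; rewrite E.
split=> [/unreached_certificate|]; first exact: certificate_partition.
by move=> part; apply/unreached_certificate/partition_certificate.
Qed.
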